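(* There exists a weakly ergodic hidden stochastic game that does not have a uniform value.
   Context: $\mathbb N^*=\{1,2,\dots\}$; $\Delta(C)$ is the set of probability distributions on a finite set $C$; $\|b\|_1=\sum_k|b(k)|$. Hidden stochastic game. A (two-player zero-sum) hidden stochastic game is a tuple $\Gamma=(\mathcal K,\mathcal I,\mathcal J,\mathcal S,p,g)$ with finite nonempty sets of states $\mathcal K$, actions $\mathcal I$ (Player 1) and $\mathcal J$ (Player 2), signals $\mathcal S$, a transition function $p:\mathcal K\times\mathcal I\times\mathcal J\to\Delta(\mathcal K\times\mathcal S)$ and a reward function $g:\mathcal K\times\mathcal I\times\mathcal J\to[0,1]$. Given an initial belief $b_1\in\Delta(\mathcal K)$, known to both players, the initial state $K_1$ is drawn from $b_1$ and not observed. At each stage $m\ge1$ the players simultaneously choose actions $I_m,J_m$; the reward $G_m=g(K_m,I_m,J_m)$ is generated (unobserved); then $(K_{m+1},S_{m+1})$ is drawn from $p(K_m,I_m,J_m)$, and both players observe $(I_m,J_m,S_{m+1})$ but not $K_{m+1}$ nor $G_m$. Histories before stage $m$: $\mathcal H_m=(\mathcal I\times\mathcal J\times\mathcal S)^{m-1}$, with $\mathcal H_1=\{\emptyset\}$. Strategies: $\sigma:\bigcup_{m\ge1}\mathcal H_m\to\Delta(\mathcal I)$ for Player 1 (set $\Sigma$), $\tau:\bigcup_{m\ge1}\mathcal H_m\to\Delta(\mathcal J)$ for Player 2 (set $\mathcal T$). $\mathbb P^{b_1}_{\sigma,\tau}$, $\mathbb E^{b_1}_{\sigma,\tau}$ are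 the induced probability and expectation on plays, and $H_m=(I_1,J_1,S_2,\dots,I_{m-1},J_{m-1},S_m)$. Admissible histories from $b_1$: $\mathcal H_m(b_1)=\{h_m\in\mathcal H_m:\exists(\sigma,\tau)\in\Sigma\times\mathcal T,\ \mathbb P^{b_1}_{\sigma,\tau}(H_m=h_m)>0\}$. For $h_m\in\mathcal H_m(b_1)$, the belief after $h_m$ is $b^{b_1}_{h_m}(\cdot)=\mathbb P^{b_1}_{\sigma,\tau}(K_m=\cdot\mid H_m=h_m)$, for any $(\sigma,\tau)$ with $\mathbb P^{b_1}_{\sigma,\tau}(H_m=h_m)>0$ (it does not depend on the choice). Weak ergodicity. $\Gamma$ is weakly ergodic if for all $\varepsilon>0$ there exists $m_\varepsilon\in\mathbb N^*$ such that for every $b_1,b_1'\in\Delta(\mathcal K)$ and every $h_{m_\varepsilon}\in\mathcal H_{m_\varepsilon}(b_1)\cap\mathcal H_{m_\varepsilon}(b_1')$, $\|b^{b_1}_{h_{m_\varepsilon}}-b^{b_1'}_{h_{m_\varepsilon}}\|_1\le\varepsilon$. Uniform value. $\gamma_n(b_1,\sigma,\tau)=\mathbb E^{b_1}_{\sigma,\tau}\big(\frac1n\sum_{m=1}^nG_m\big)$. $\Gamma$ has a uniform value $v:\Delta(\mathcal K)\to[0,1]$ if for every $b_1\in\Delta(\mathcal K)$ and $\varepsilon>0$ there exist $(\sigma^*,\tau^* )\in\Sigma\times\mathcal T$ and $\overline n\in\mathbb N^*$ such that for all $n\ge\overline n$: $\gamma_n(b_1,\sigma^*,\tau)\ge v(b_1)-\varepsilon$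 for all $\tau\in\mathcal T$, and $\gamma_n(b_1,\sigma,\tau^* )\le v(b_1)+\varepsilon$ for all $\sigma\in\Sigma$. *)

(* Defs.v *)
From HB Require Import structures.
From mathcomp Require Import all_boot all_order all_algebra.
From mathcomp Require Import all_classical all_reals.

Set Implicit Arguments.
Unset Strict Implicit.
Unset Printing Implicit Defensive.

Import Order.TTheory GRing.Theory Num.Theory.

Local Open Scope ring_scope.

Record dist (R : realType) (C : finType) := Dist {
  pmass :> {ffun C -> R};
  _ : [forall c, 0 <= pmass c] && (\sum_c pmass c == 1)
}.

Record hidden_game (R : realType) := HiddenGame {
  state : finType;
  action1 : finType;
  action2 : finType;
  signal : finType;
  transition : state -> action1 -> action2 -> dist R (state * signal)%type;
  reward : state -> action1 -> action2 -> R;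
  state_gt0 : (0 < #|state|)%N;
  action1_gt0 : (0 < #|action1|)%N;
  action2_gt0 : (0 < #|action2|)%N;
  signal_gt0 : (0 < #|signal|)%N;
  reward_bounds : forall k i j, 0 <= reward k i j <= 1
}.

(* What both players observe at the end of a stage m: (I_m, J_m, S_(m+1)). *)
Definition observation (R : realType) (G : hidden_game R) : finType :=
  (action1 G * action2 G * signal G)%type.

(* What happens during a stage m: ((I_m, J_m), (K_(m+1), S_(m+1))). *)
Definition step (R : realType) (G : hidden_game R) : finType :=
  ((action1 G * action2 G) * (state G * signal G))%type.

Definition observe (R : realType) (G : hidden_game R) (x : step G) :
  observation G := (x.1, x.2.2).

(* Stages are numbered from 1: H_m has m - 1 entries. *)
Definition history (R : realType) (G : hidden_game R) (m : nat) : finType :=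
  (m.-1).-tuple (observation G).

(* The disjoint union of the sets H_m over m >= 1 is [seq (observation G)]. *)
Definition strategy1 (R : realType) (G : hidden_game R) :=
  seq (observation G) -> dist R (action1 G).
Definition strategy2 (R : realType) (G : hidden_game R) :=
  seq (observation G) -> dist R (action2 G).

(* A play up to stage m: K_1 together with the first m - 1 steps, that is
   (K_1, I_1, J_1, K_2, S_2, ..., I_(m-1), J_(m-1), K_m, S_m).  H_m, K_m and
   the rewards G_1, ..., G_(m-1) are functions of it, so the laws of these
   finite plays are all that is needed of the measure on infinite plays. *)
Definition play (R : realType) (G : hidden_game R) (m : nat) : finType :=
  (state G * (m.-1).-tuple (step G))%type.

Definition play_history (R : realType) (G : hidden_game R) (m : nat)
  (w : play G m) : history G m := [tuple of map (@observe R G) w.2].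

Definition play_state (R : realType) (G : hidden_game R) (m : nat)
  (w : play G m) : state G := last w.1 [seq x.2.1 | x <- w.2].

(* Conditional probability that the next steps are [w], when the current
   history is [h] and the current state is [k]. *)
Fixpoint steps_prob (R : realType) (G : hidden_game R)
    (sigma : strategy1 G) (tau : strategy2 G) (h : seq (observation G))
    (k : state G) (w : seq (step G)) {struct w} : R :=
  match w with
  | [::] => 1
  | ((i, j), (k', s)) :: w' =>
      sigma h i * tau h j * transition k i j (k', s) *
      steps_prob sigma tau (rcons h (i, j, s)) k' w'
  end.

Definition play_prob (R : realType) (G : hidden_game R) (b : dist R (state G))
    (sigma : strategy1 G) (tau : strategy2 G) (m : nat) (w : play G m) : R :=
  b w.1 * steps_prob sigma tau [::] w.1 w.2.

Definition Pr (R : realType) (G : hidden_game R) (b : dist R (state G))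
    (sigma : strategy1 G) (tau : strategy2 G) (m : nat)
    (A : pred (play G m)) : R :=
  \sum_(w : play G m | A w) play_prob b sigma tau w.

Definition Ex (R : realType) (G : hidden_game R) (b : dist R (state G))
    (sigma : strategy1 G) (tau : strategy2 G) (m : nat)
    (X : play G m -> R) : R :=
  \sum_(w : play G m) play_prob b sigma tau w * X w.

Definition history_prob (R : realType) (G : hidden_game R)
    (b : dist R (state G)) (sigma : strategy1 G) (tau : strategy2 G)
    (m : nat) (h : history G m) : R :=
  Pr b sigma tau [pred w : play G m | play_history w == h].

Definition admissible (R : realType) (G : hidden_game R)
    (b : dist R (state G)) (m : nat) (h : history G m) : Prop :=
  exists (sigma : strategy1 G) (tau : strategy2 G),
    0 < history_prob b sigma tau h.

(* The conditional law of K_m given H_m = h; meaningful when the event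
   H_m = h has positive probability. *)
Definition posterior (R : realType) (G : hidden_game R)
    (b : dist R (state G)) (sigma : strategy1 G) (tau : strategy2 G)
    (m : nat) (h : history G m) : {ffun state G -> R} :=
  [ffun k => Pr b sigma tau
       [pred w : play G m | (play_state w == k) && (play_history w == h)]
     / history_prob b sigma tau h].

(* The posterior for some pair of strategies under which h has positive
   probability (lemma [belief_posterior]: any such pair gives the same one);
   the junk value 0 is taken only when h is not admissible from b. *)
Definition belief (R : realType) (G : hidden_game R)
    (b : dist R (state G)) (m : nat) (h : history G m) : {ffun state G -> R} :=
  xget [ffun=> 0] [set beta | exists (sigma : strategy1 G) (tau : strategy2 G),
    0 < history_prob b sigma tau h /\ beta = posterior b sigma tau h]%classic.

Definition weakly_ergodic (R : realType) (G : hidden_game R) : Prop :=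
  forall eps : R, 0 < eps ->
  exists m : nat, (0 < m)%N /\
    forall (b b' : dist R (state G)) (h : history G m),
      admissible b h -> admissible b' h ->
      \sum_(k : state G) `|belief b h k - belief b' h k| <= eps.

(* The rewards along the steps [w] from the state [k], in order. *)
Fixpoint rewards (R : realType) (G : hidden_game R) (k : state G)
    (w : seq (step G)) {struct w} : seq R :=
  match w with
  | [::] => [::]
  | ((i, j), (k', _)) :: w' => reward k i j :: rewards k' w'
  end.

(* G_1, ..., G_n are functions of the play up to stage n + 1. *)
Definition gamma (R : realType) (G : hidden_game R) (n : nat)
    (b : dist R (state G)) (sigma : strategy1 G) (tau : strategy2 G) : R :=
  Ex b sigma tau
    (fun w : play G n.+1 => n%:R^-1 * \sum_(r <- rewards w.1 w.2) r).

Definition is_uniform_value (R : realType) (G : hidden_game R)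
    (v : dist R (state G) -> R) : Prop :=
  (forall b, 0 <= v b <= 1) /\
  forall (b : dist R (state G)) (eps : R), 0 < eps ->
  exists (sigma' : strategy1 G) (tau' : strategy2 G) (nbar : nat),
    (0 < nbar)%N /\
    forall n : nat, (nbar <= n)%N ->
      (forall tau : strategy2 G, v b - eps <= gamma n b sigma' tau) /\
      (forall sigma : strategy1 G, gamma n b sigma tau' <= v b + eps).

Definition has_uniform_value (R : realType) (G : hidden_game R) : Prop :=
  exists v : dist R (state G) -> R, is_uniform_value v.

(* A play probability is the product of [choice_prob], which depends only on
   the observations, and of a factor that does not involve the strategies. *)
Fixpoint choice_prob (R : realType) (G : hidden_game R)
    (sigma : strategy1 G) (tau : strategy2 G) (h : seq (observation G))
    (o : seq (observation G)) {struct o} : R :=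
  match o with
  | [::] => 1
  | ((i, j), s) :: o' =>
      sigma h i * tau h j * choice_prob sigma tau (rcons h (i, j, s)) o'
  end.

Fixpoint nature_prob (R : realType) (G : hidden_game R) (k : state G)
    (w : seq (step G)) {struct w} : R :=
  match w with
  | [::] => 1
  | ((i, j), (k', s)) :: w' =>
      transition k i j (k', s) * nature_prob k' w'
  end.

Lemma steps_probE (R : realType) (G : hidden_game R)
    (sigma : strategy1 G) (tau : strategy2 G) (w : seq (step G)) h k :
  steps_prob sigma tau h k w =
  choice_prob sigma tau h (map (@observe R G) w) * nature_prob k w.
Proof.
elim: w h k => [|[[i j] [k' s]] w IHw] h k /=; first by rewrite mulr1.
by rewrite IHw -!mulrA; congr (_ * (_ * _)); rewrite mulrCA.
Qed.

Lemma Pr_history (R : realType) (G : hidden_game R) (b : dist R (state G))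
    (sigma : strategy1 G) (tau : strategy2 G) (m : nat) (h : history G m)
    (A : pred (play G m)) :
  Pr b sigma tau [pred w : play G m | A w && (play_history w == h)] =
  choice_prob sigma tau [::] h *
  \sum_(w : play G m | A w && (play_history w == h))
     b w.1 * nature_prob w.1 w.2.
Proof.
rewrite /Pr mulr_sumr; apply: eq_bigr => w /andP[_ /eqP <-].
by rewrite /play_prob steps_probE mulrCA.
Qed.

Lemma belief_posterior (R : realType) (G : hidden_game R)
    (b : dist R (state G)) (m : nat) (h : history G m)
    (sigma : strategy1 G) (tau : strategy2 G) :
  0 < history_prob b sigma tau h -> belief b h = posterior b sigma tau h.
Proof.
move=> hp; rewrite /belief; case: xgetP => [_ _ [s [t [hp' ->]]] | none]; last first.
  by case: (none (posterior b sigma tau h)); exists sigma, tau.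
have E s' t' : history_prob b s' t' h = choice_prob s' t' [::] h *
    \sum_(w : play G m | true && (play_history w == h))
       b w.1 * nature_prob w.1 w.2 by exact: (Pr_history b s' t' h predT).
have cancel s' t' x : 0 < history_prob b s' t' h ->
    (choice_prob s' t' [::] h * x) / history_prob b s' t' h =
    x / \sum_(w : play G m | true && (play_history w == h))
       b w.1 * nature_prob w.1 w.2.
  move=> /gt_eqF; rewrite E => /negbT; rewrite mulf_eq0 negb_or => /andP[c0 _].
  by rewrite -mulf_div divff // mul1r.
apply/ffunP => k; rewrite !ffunE !Pr_history.
by rewrite cancel // cancel.
Qed.

(* Main.v *)
Require Import Defs.
From mathcomp Require Import all_boot all_order all_algebra.
From mathcomp Require Import all_classical all_reals.
From mathcomp Require Import ring lra zify.

(* Only the active player acts.  The reward is 0 while Player 1 is active and 1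
   while Player 2 is, so each player wants to hand the game over.  The active
   player owns a clock, which each time she waits advances with probability
   1/c and is reset otherwise; she is surely flawed at a reset, and a flaw
   survives each advance with probability 1/c.  Stopping hands the game over if
   she is not flawed, and freezes the game on her side for ever if she is.
   Reaching level j thus takes about c^j stages and leaves a risk c^(-j).
   Player 1 may only stop at odd levels and Player 2 at even ones.  With
   n = c^(2k) stages to play, the player for whom level k is allowed stops there,
   which costs her of the order of c^k stages per turn, risk included; her
   opponent must stop at a level at most k - 1, with c times the risk, or at
   least k + 1, after c times as long.  Either way she loses only a fraction 6/c
   of the n stages, so that for c = 24 the n-stage values are alternately at
   least 3/4 and at most 1/4.  The signals reveal everything but the flaw, whose
   probability is divided by c at each advance and does not depend on the past
   at each reset or change of turn: the initial belief is forgotten. *)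

Set Implicit Arguments.
Unset Strict Implicit.
Unset Printing Implicit Defensive.

Import Order.TTheory GRing.Theory Num.Theory.

Local Open Scope ring_scope.

(** * Finite distributions as weighted lists of outcomes *)

Section Distributions.
Context (R : realType) (C : finType).

Lemma dist_ge0 (b : dist R C) c : 0 <= b c.
Proof. by case: b => f /= /andP[/forallP /(_ c)]. Qed.

Lemma dist_sum (b : dist R C) : \sum_c b c = 1.
Proof. by case: b => f /= /andP[_ /eqP]. Qed.

(** Lists keep the few possible outcomes explicit, so that expectations unfold to short sums that
    [ring] can settle. *)
Definition is_weighting (l : seq (R * C)) :=
  all (fun x => 0 <= x.1) l && (\sum_(x <- l) x.1 == 1).

Definition mixture_mass (l : seq (R * C)) : {ffun C -> R} :=
  [ffun c => \sum_(x <- l) x.1 * (x.2 == c)%:R].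

Lemma mixture_mass_sum (l : seq (R * C)) (F : C -> R) :
  \sum_c mixture_mass l c * F c = \sum_(x <- l) x.1 * F x.2.
Proof.
under eq_bigr => c _ do rewrite ffunE mulr_suml.
rewrite exchange_big; apply: eq_bigr => x _ /=.
rewrite (bigD1 x.2) //= eqxx mulr1 big1 ?addr0 // => c /negbTE.
by rewrite eq_sym => ->; rewrite mulr0 mul0r.
Qed.

Lemma mixture_subproof (l : seq (R * C)) (hl : is_weighting l) :
  [forall c, 0 <= mixture_mass l c] && (\sum_c mixture_mass l c == 1).
Proof.
case/andP: hl => /allP l_ge0 /eqP l_sum; apply/andP; split.
  apply/forallP => c; rewrite ffunE big_seq.
  by apply: sumr_ge0 => x /l_ge0 x_ge0; rewrite mulr_ge0.
under eq_bigr => c _ do rewrite -[mixture_mass l c]mulr1.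
rewrite (mixture_mass_sum l (fun=> 1)).
by under eq_bigr => x _ do rewrite mulr1; rewrite l_sum.
Qed.

Definition mixture (l : seq (R * C)) (hl : is_weighting l) : dist R C :=
  Dist (mixture_subproof hl).

Lemma is_weighting1 (c : C) : is_weighting [:: (1, c)].
Proof. by rewrite /is_weighting /= ler01 big_seq1 eqxx. Qed.

Definition dirac (c : C) : dist R C := mixture (is_weighting1 c).

Lemma diracE (c c' : C) : dirac c c' = (c == c')%:R.
Proof. by rewrite /= ffunE big_seq1 mul1r. Qed.

Lemma dirac_sum (c : C) (F : C -> R) : \sum_c' dirac c c' * F c' = F c.
Proof. by rewrite mixture_mass_sum big_seq1 mul1r. Qed.

End Distributions.

(** * Expected totals of a cost per stage *)

Lemma big_tuple_cons (R : nmodType) (T : finType) n (F : seq T -> R) :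
  \sum_(w : n.+1.-tuple T) F w = \sum_x \sum_(w : n.-tuple T) F (x :: w).
Proof.
rewrite pair_big /=.
rewrite (reindex (fun p : T * n.-tuple T => [tuple of p.1 :: p.2])) //=.
exists (fun w => (thead w, [tuple of behead w])) => [[x w] _ | w _] /=.
  by congr pair; apply: val_inj.
by rewrite [w in RHS]tuple_eta.
Qed.

Lemma big_tuple0 (R : nmodType) (T : finType) (F : seq T -> R) :
  \sum_(w : 0.-tuple T) F w = F [::].
Proof.
rewrite (bigD1 [tuple]) //= big1 ?addr0 // => w /negP[].
by apply/eqP/val_inj; case: w => -[].
Qed.

Section Totals.
Context (R : realType) (G : hidden_game R).
Implicit Types (sigma : strategy1 G) (tau : strategy2 G) (k : state G).

Lemma step_sum (F : step G -> R) : \sum_x F x =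
  \sum_(a : action1 G * action2 G) \sum_(y : state G * signal G) F (a, y).
Proof. by rewrite pair_big; apply: eq_bigr => -[]. Qed.

Lemma actions_sum sigma tau h :
  \sum_(a : action1 G * action2 G) sigma h a.1 * tau h a.2 = 1.
Proof.
transitivity (\sum_i \sum_j sigma h i * tau h j); first by rewrite pair_big.
rewrite -[RHS](dist_sum (sigma h)); apply: eq_bigr => i _.
by rewrite -mulr_sumr dist_sum mulr1.
Qed.

Lemma actions_distr_sum sigma tau h (x : R) :
  \sum_(a : action1 G * action2 G) sigma h a.1 * tau h a.2 * x = x.
Proof. by rewrite -mulr_suml actions_sum mul1r. Qed.

Lemma steps_prob_sum sigma tau n h k :
  \sum_(w : n.-tuple (step G)) steps_prob sigma tau h k w = 1.
Proof.
elim: n h k => [|n IHn] h k; first by rewrite big_tuple0.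
rewrite big_tuple_cons step_sum -(actions_sum sigma tau h).
apply: eq_bigr => -[i j] _ /=.
rewrite -[RHS]mulr1 -(dist_sum (transition k i j)) mulr_sumr.
by apply: eq_bigr => -[k' s] _; rewrite -mulr_sumr IHn mulr1.
Qed.

Fixpoint path_sum (phi : state G -> R) (k : state G) (w : seq (step G)) : R :=
  if w is x :: w' then phi k + path_sum phi x.2.1 w' else 0.

Definition path_total phi sigma tau n h k : R :=
  \sum_(w : n.-tuple (step G)) steps_prob sigma tau h k w * path_sum phi k w.

Lemma path_total0 phi sigma tau h k : path_total phi sigma tau 0 h k = 0.
Proof.
rewrite /path_total.
by rewrite (big_tuple0 (fun w => steps_prob sigma tau h k w * path_sum phi k w)) mulr0.
Qed.

(** Conditioning on the first stage: the continuations have total probability 1, so the present cost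
    factors out of the sum. *)
Lemma path_totalS phi sigma tau n h k : path_total phi sigma tau n.+1 h k = phi k +
  \sum_(a : action1 G * action2 G) sigma h a.1 * tau h a.2 *
    \sum_(y : state G * signal G) transition k a.1 a.2 y *
      path_total phi sigma tau n (rcons h (a, y.2)) y.1.
Proof.
rewrite /path_total.
rewrite (big_tuple_cons _ (fun w => steps_prob sigma tau h k w * path_sum phi k w)).
rewrite -[phi k in RHS]mul1r -(actions_sum sigma tau h) mulr_suml -big_split.
rewrite step_sum; apply: eq_bigr => -[i j] _ /=.
rewrite -mulrDr -[phi k in RHS]mul1r -(dist_sum (transition k i j)) mulr_suml.
rewrite -big_split mulr_sumr; apply: eq_bigr => -[k' s] _ /=.
rewrite -mulrDr mulrA -[phi k in RHS]mul1r.
rewrite -(steps_prob_sum sigma tau n (rcons h (i, j, s)) k') mulr_suml.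
rewrite -big_split mulr_sumr; apply: eq_bigr => w _ /=.
by rewrite -mulrDr !mulrA.
Qed.

Lemma path_total_le phi sigma tau n h k : (forall k', phi k' <= 1) ->
  path_total phi sigma tau n h k <= n%:R.
Proof.
move=> phi_le1; elim: n h k => [|n IHn] h k; first by rewrite path_total0.
rewrite path_totalS -nat1r lerD //.
rewrite -[leRHS]mul1r -[X in _ <= X * _](actions_sum sigma tau h) mulr_suml.
apply: ler_sum => -[i j] _ /=; rewrite ler_wpM2l ?mulr_ge0 ?dist_ge0 //.
rewrite -[leRHS]mul1r -[X in _ <= X * _](dist_sum (transition k i j)) mulr_suml.
by apply: ler_sum => y _; rewrite ler_wpM2l ?dist_ge0.
Qed.

Lemma path_totalD phi psi sigma tau n h k :
  path_total (fun k' => phi k' + psi k') sigma tau n h k =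
  path_total phi sigma tau n h k + path_total psi sigma tau n h k.
Proof.
rewrite /path_total -big_split; apply: eq_bigr => w _ /=.
rewrite -mulrDr; congr (_ * _).
elim: (w : seq _) k => [|x w' IHw] k' /=; first by rewrite addr0.
by rewrite IHw addrACA.
Qed.

Lemma path_total1 sigma tau n h k : path_total (fun=> 1) sigma tau n h k = n%:R.
Proof.
rewrite /path_total.
have path_sum1 w k' : path_sum (fun=> 1) k' w = (size w)%:R.
  by elim: w k' => //= x w IHw k'; rewrite IHw nat1r.
under eq_bigr => w _ do rewrite path_sum1 size_tuple.
by rewrite -mulr_suml steps_prob_sum mul1r.
Qed.

Lemma gammaE phi n (b : dist R (state G)) sigma tau :
  (forall k i j, reward k i j = phi k) ->
  gamma n b sigma tau = n%:R^-1 * \sum_k b k * path_total phi sigma tau n [::] k.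
Proof.
move=> phiE; rewrite /gamma /Ex mulr_sumr.
transitivity (\sum_k \sum_(w : n.-tuple (step G)) n%:R^-1 *
    (b k * (steps_prob sigma tau [::] k w * path_sum phi k w))).
  rewrite pair_big /=; apply: eq_bigr => -[k w] _ /=.
  have -> : \sum_(r <- rewards k w) r = path_sum phi k w.
    elim: (w : seq _) k => [|[[i j] [k' s]] w' IHw] k /=; first by rewrite big_nil.
    by rewrite big_cons phiE IHw.
  by rewrite /play_prob /= mulrCA !mulrA.
by apply: eq_bigr => k _; rewrite -!mulr_sumr.
Qed.

End Totals.

(** * The game and its public positions *)

Section Game.
Context (R : realType).

(* [(rho, None)]: player [rho] has lost; [(rho, Some None)]: her clock has just
   been reset, and she is surely flawed; [(rho, Some (Some (odd, bad)))]: her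
   clock has advanced an odd or even number of times, and [bad] says whether
   she is still flawed.  Player 1 is [true]. *)
Definition hidden_state : finType := (bool * option (option (bool * bool)))%type.
Definition public_state : finType := (bool * option (option bool))%type.

Definition publicize (k : hidden_state) : public_state :=
  (k.1, omap (omap fst) k.2).

Definition rate : R := 24%:R^-1.

Lemma rate_gt0 : 0 < rate. Proof. by rewrite /rate; lra. Qed.
Lemma rate_lt1 : rate < 1. Proof. by rewrite /rate; lra. Qed.
Lemma rate_ge0 : 0 <= rate. Proof. exact: ltW rate_gt0. Qed.
Lemma rate_le1 : rate <= 1. Proof. exact: ltW rate_lt1. Qed.

(** [bad_prob] is the probability of a flaw given that the clock advances. *)
Definition continue_outcomes (rho : bool) (odd : bool) (bad_prob : R) :
    seq (R * hidden_state) :=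
  [:: (1 - rate, (rho, Some None)); (rate * bad_prob, (rho, Some (Some (odd, true))));
      (rate * (1 - bad_prob), (rho, Some (Some (odd, false))))].

Definition outcomes (k : hidden_state) (stop : bool) : seq (R * hidden_state) :=
  let: (rho, c) := k in
  match c, stop with
  | None, _ => [:: (1, (rho, None))]
  | Some None, true => [:: (1, (rho, Some None))]
  | Some None, false => continue_outcomes rho true rate
  | Some (Some (odd, bad)), true =>
      [:: (1, if odd != rho then (rho, Some None)
              else if bad then (rho, None) else (~~ rho, Some None))]
  | Some (Some (odd, bad)), false =>
      continue_outcomes rho (~~ odd) (if bad then rate else 0)
  end.

Definition signalled_outcomes k stop : seq (R * (hidden_state * public_state)) :=
  [seq (x.1, (x.2, publicize x.2)) | x <- outcomes k stop].

Lemma signalled_outcomes_weighting k stop : is_weighting (signalled_outcomes k stop).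
Proof.
have q0 := rate_gt0; have q1 := rate_lt1.
have cont rho odd p : 0 <= p <= 1 ->
    is_weighting [seq (x.1, (x.2, publicize x.2)) | x <- continue_outcomes rho odd p].
  move=> p01; rewrite /is_weighting /= !big_cons big_nil /=.
  by apply/andP; split; [rewrite !mulr_ge0 ?subr_ge0 //; lra | apply/eqP; ring].
case: k => rho [[[odd bad]|]|]; case: stop; rewrite /signalled_outcomes;
  try exact: is_weighting1; apply: cont; last lra.
by case: bad; lra.
Qed.

Definition law k stop : dist R (hidden_state * public_state)%type :=
  mixture (signalled_outcomes_weighting k stop).

Lemma law_sum k stop (F : hidden_state * public_state -> R) :
  \sum_y law k stop y * F y =
  \sum_(x <- outcomes k stop) x.1 * F (x.2, publicize x.2).
Proof. by rewrite mixture_mass_sum big_map. Qed.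

Definition active (rho : bool) (a : bool * bool) : bool := if rho then a.1 else a.2.

Lemma inhabited_card_gt0 (T : finType) (x : T) : (0 < #|T|)%N.
Proof. by apply/card_gt0P; exists x. Qed.

Lemma reward_in01 (k : hidden_state) (i j : bool) : 0 <= ((~~ k.1)%:R : R) <= 1.
Proof. by case: k.1; rewrite /= ?lexx ler01. Qed.

Definition game : hidden_game R :=
  @HiddenGame R hidden_state bool bool public_state
    (fun k i j => law k (active k.1 (i, j))) (fun k _ _ => (~~ k.1)%:R)
    (inhabited_card_gt0 (true, None)) (inhabited_card_gt0 true) (inhabited_card_gt0 true)
    (inhabited_card_gt0 (true, None)) reward_in01.

(* The commonly known position: the active player and how often her clock has
   advanced since its last reset. *)
Definition position := (bool * option nat)%type.

Definition announced (x : position) : public_state :=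
  (x.1, omap (fun j => if j is _.+1 then Some (odd j) else None) x.2).

(** Signals show only the parity of the level, which is recovered by counting advances. The default
    0 serves only signals incompatible with a lost position. *)
Definition update (x : position) (s : public_state) : position :=
  (s.1, omap (fun c => if c is Some _ then (odflt 0%N x.2).+1 else 0%N) s.2).

Definition position_after (x : position) (h : seq (observation game)) : position :=
  foldl (fun y o => update y o.2) x h.

(** The flaw, certain at a reset, survives [j] advances with probability [rate ^+ j]. *)
Definition belief_at (x : position) : seq (R * hidden_state) :=
  match x with
  | (rho, None) => [:: (1, (rho, None))]
  | (rho, Some 0%N) => [:: (1, (rho, Some None))]
  | (rho, Some j) => [:: (rate ^+ j, (rho, Some (Some (odd j, true))));
                         (1 - rate ^+ j, (rho, Some (Some (odd j, false))))]
  end.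

Definition moves (x : position) (stop : bool) : seq (R * position) :=
  match x, stop with
  | (rho, None), _ => [:: (1, x)]
  | (rho, Some j), true =>
      if (0 < j)%N && (odd j == rho)
      then [:: (rate ^+ j, (rho, None)); (1 - rate ^+ j, (~~ rho, Some 0%N))]
      else [:: (1, (rho, Some 0%N))]
  | (rho, Some j), false => [:: (1 - rate, (rho, Some 0%N)); (rate, (rho, Some j.+1))]
  end.

Lemma moves_ge0 x stop t : t \in moves x stop -> 0 <= t.1.
Proof.
have q0 := rate_ge0; have q1 := rate_le1.
have qX j : 0 <= 1 - rate ^+ j by rewrite subr_ge0 exprn_ile1.
by case: x stop => rho [j|] [] /=; [case: ifP => _| |..]; rewrite !inE;
   do ?[case/orP]; move/eqP=> -> //=; rewrite ?subr_ge0 ?exprn_ge0.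
Qed.

Lemma moves_sum x stop : \sum_(t <- moves x stop) t.1 = 1.
Proof.
by case: x stop => rho [j|] [] /=; [case: ifP => _| |..];
   rewrite !big_cons big_nil /=; ring.
Qed.

Lemma update_moves x stop t : t \in moves x stop -> update x (announced t.2) = t.2.
Proof.
by case: x stop => rho [[|j]|] [] //=; [| | case: ifP => _ | |..]; rewrite !inE;
   do ?[case/orP]; move/eqP=> -> //=; case: rho.
Qed.

(** Bayes' rule, checked case by case. It makes the position a sufficient statistic: the flaw may be
    redrawn from [belief_at] after each public move. *)
Lemma filter_step x stop (F : public_state -> hidden_state -> R) :
  \sum_(z <- belief_at x) z.1 *
    (\sum_(y <- outcomes z.2 stop) y.1 * F (publicize y.2) y.2) =
  \sum_(t <- moves x stop) t.1 *
    (\sum_(z <- belief_at t.2) z.1 * F (announced t.2) z.2).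
Proof.
case: x => rho [[|j]|]; case: stop;
  rewrite /= ?big_cons ?big_nil /publicize /announced /= ?big_cons ?big_nil /= ?exprS;
  case: rho; try (case: (odd j));
  rewrite /= ?big_cons ?big_nil /= ?big_cons ?big_nil /=; ring.
Qed.

(** * Bounding the expected loss by a potential *)

Section Guarantee.
Context (sigma : strategy1 game) (tau : strategy2 game) (d : bool).

(* Rewards are 0 in the region of Player 1 and 1 in that of Player 2, so either
   player loses one unit at each stage where she is the active one. *)
Definition loss n (h : seq (observation game)) (k : hidden_state) : R :=
  path_total (fun k' : state game => (k'.1 == d)%:R) sigma tau n h k.

Definition expected_loss n h (x : position) : R :=
  \sum_(z <- belief_at x) z.1 * loss n h z.2.

Lemma belief_at_sum x (a : R) : \sum_(z <- belief_at x) z.1 * a = a.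
Proof.
by case: x => rho [[|j]|] /=; rewrite !big_cons big_nil /=; ring.
Qed.

Lemma expected_loss_le n h x : expected_loss n h x <= n%:R.
Proof.
rewrite -[leRHS](belief_at_sum x) /expected_loss big_seq [leRHS]big_seq.
apply: ler_sum => z z_in; apply: ler_wpM2l; last first.
  by apply: path_total_le => k; case: eqP.
have q0 := rate_ge0; have q1 := rate_le1.
have qX j : 0 <= 1 - rate ^+ j by rewrite subr_ge0 exprn_ile1.
case: x z_in => rho [[|j]|] /=; rewrite !inE;
   do ?[case/orP]; move/eqP=> -> //=; by rewrite exprn_ge0.
Qed.

Lemma expected_loss0 h x : expected_loss 0 h x = 0.
Proof. by rewrite /expected_loss big1 // => z _; rewrite /loss path_total0 mulr0. Qed.

Lemma expected_lossS n h x : expected_loss n.+1 h x = (x.1 == d)%:R +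
  \sum_(a : bool * bool) sigma h a.1 * tau h a.2 *
    (\sum_(t <- moves x (active x.1 a)) t.1 *
       expected_loss n (rcons h (a, announced t.2)) t.2).
Proof.
have region z : z \in belief_at x -> z.2.1 = x.1.
  by case: x => rho [[|j]|] /=; rewrite !inE; do ?[case/orP]; move/eqP=> ->.
rewrite -[(x.1 == d)%:R](belief_at_sum x) /expected_loss.
under [X in _ = _ + X]eq_bigr => a _.
  rewrite -(filter_step x (active x.1 a) (fun s k => loss n (rcons h (a, s)) k)).
  rewrite mulr_sumr; over.
rewrite exchange_big -big_split big_seq [RHS]big_seq.
apply: eq_bigr => z z_in; rewrite /loss path_totalS mulrDr (region z z_in) /=.
congr (_ + _); rewrite mulr_sumr; apply: eq_bigr => -[i j] _.
rewrite law_sum (region z z_in) /=.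
by rewrite mulrCA.
Qed.

(** A supermartingale argument, by induction on the remaining stages. Drift is asked only for
    actions of positive probability, so a pure strategy of [d] is tested on its own action alone,
    against any opponent. *)
Lemma lyapunov_bound (x0 : position) (l : position -> R) (delta : R) (N : nat) :
  (forall x, 0 <= l x) -> 0 <= delta -> N%:R <= l (d, None) ->
  (forall h a, sigma h a.1 * tau h a.2 != 0 ->
     let x := position_after x0 h in x != (d, None) ->
     (x.1 == d)%:R + \sum_(t <- moves x (active x.1 a)) t.1 * l t.2 <= l x + delta) ->
  forall n h, (n <= N)%N ->
  expected_loss n h (position_after x0 h) <= l (position_after x0 h) + n%:R * delta.
Proof.
move=> l_ge0 delta_ge0 l_dead drift; elim=> [|n IHn] h n_le.
  by rewrite expected_loss0 mul0r addr0.
set x := position_after x0 h.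
(* No drift is assumed once [d] has lost, but at most [N] stages remain and [l (d, None)] covers
   them all. *)
have [->|x_alive] := eqVneq x (d, None).
  apply: le_trans (expected_loss_le _ _ _) _.
  rewrite -[leLHS]addr0 lerD ?mulr_ge0 //.
  by apply: le_trans l_dead; rewrite ler_nat.
rewrite expected_lossS -[X in X%:R * _]addn1 natrD mulrDl mul1r [_ + delta]addrC addrA.
rewrite -(actions_distr_sum sigma tau h (_ == d)%:R).
rewrite -(actions_distr_sum sigma tau h (l x + delta + _)) -big_split /=.
apply: ler_sum => a _; rewrite -mulrDr.
have [->|a_pos] := eqVneq (sigma h a.1 * tau h a.2) 0; first by rewrite !mul0r.
apply: ler_wpM2l; first by rewrite mulr_ge0 ?dist_ge0.
apply: le_trans (_ : (x.1 == d)%:R +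
  \sum_(t <- moves x (active x.1 a)) (t.1 * l t.2 + t.1 * (n%:R * delta)) <= _).
  rewrite lerD2l big_seq [leRHS]big_seq; apply: ler_sum => t t_in.
  rewrite -mulrDr ler_wpM2l ?(moves_ge0 t_in) //.
  have := IHn (rcons h (a, announced t.2)) (ltnW n_le).
  by rewrite /position_after foldl_rcons /= (update_moves t_in).
rewrite big_split -mulr_suml moves_sum mul1r addrA lerD2r.
exact: drift.
Qed.

End Guarantee.

(** * Stopping at a fixed level and its potential *)

Definition start : position := (true, Some 0%N).

Definition stop_at (d : bool) (k : nat) (h : seq (observation game)) : dist R bool :=
  dirac R (position_after start h == (d, Some k)).

Definition stops_at sigma tau (d : bool) (k : nat) : Prop :=
  forall h, (if d then sigma h else tau h) = stop_at d k h.

(* With [k = m.+1] and [A = 24 ^ m], the horizon is [24 ^ (2 * k) = 576 * A ^ 2];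
   reaching level [k] takes about [24 ^ k] stages and is the best compromise
   between the time spent and the risk [24 ^ -k]. *)
Definition lyapunov (d : bool) (m : nat) (x : position) : R :=
  let A := 24%:R ^+ m in
  match x.2 with
  | None => if x.1 == d then 576%:R * A ^+ 2 else 0
  | Some j =>
    if x.1 == d
    then if (j <= m.+1)%N then 72%:R * A ^+ 2 - 2%:R * (24%:R ^+ j - 1)
         else 72%:R * A ^+ 2 + 2%:R
    else 72%:R * A ^+ 2 - 72%:R * A + 8%:R^-1 * (24%:R ^+ j - 1)
  end.

Lemma pow24_ge1 j : 1 <= 24%:R ^+ j :> R.
Proof. by rewrite exprn_ege1 // ler1n. Qed.

Lemma lyapunov_ge0 d m x : 0 <= lyapunov d m x.
Proof.
have A1 := pow24_ge1 m.
case: x => rho [j|]; rewrite /lyapunov /=; last by case: ifP; nra.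
have y1 := pow24_ge1 j.
case: ifP => _; last by nra.
case: ifP => [j_le|_]; last by nra.
have : 24%:R ^+ j <= 24%:R ^+ m.+1 :> R by rewrite ler_eXn2l // ltr1n.
by rewrite exprS; nra.
Qed.

Lemma lyapunov_drift d m x stop : odd m.+1 = d -> x != (d, None) ->
  (x.1 = d -> stop = (x == (d, Some m.+1))) ->
  (x.1 == d)%:R + \sum_(t <- moves x stop) t.1 * lyapunov d m t.2 <=
  lyapunov d m x + 8%:R^-1.
Proof.
have A1 := pow24_ge1 m.
move=> odd_k; case: x => rho [j|] /=; last first.
  have [->|/negbTE rho_d _ _] := eqVneq rho d; first by rewrite eqxx.
  by rewrite big_seq1 /lyapunov /= rho_d; lra.
move=> _ own; have y1 := pow24_ge1 j.
have zy : rate ^+ j * 24%:R ^+ j = 1 by rewrite -exprMn mulVf ?expr1n // pnatr_eq0.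
set A := 24%:R ^+ m in A1 *; set y := 24%:R ^+ j in y1 zy *.
set z := rate ^+ j in zy *.
have z_ge0 : 0 <= z by rewrite exprn_ge0 // rate_ge0.
have [rho_d|rho_d] := eqVneq rho d.
  have levelE : ((d, Some j) == (d, Some m.+1)) = (j == m.+1) by rewrite xpair_eqE eqxx.
  rewrite {own}(own rho_d) rho_d levelE.
  have [jE|j_neq] := eqVneq j m.+1.
    (* Since [z] is the inverse of [24 * A], the risk of losing adds [21 * A + 3] to the mean
       potential, while handing over lowers it by [24 * A + 2]; the margin pays for the stage. *)
    have yE : y = 24%:R * A by rewrite /y jE exprS.
    rewrite jE odd_k eqxx /= !big_cons big_nil /lyapunov /= eqxx leqnn.
    rewrite (_ : (~~ d == d) = false); last by case: (d).
    by rewrite -jE -/y -/z -/A; nra.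
  rewrite !big_cons big_nil /lyapunov /= eqxx (exprS _ j) -/y -/A /rate.
  have [j_lt|j_ge] := ltnP j m.+1; first by rewrite (ltnW j_lt); lra.
  (* Levels above the target are never reached from [start] under [stop_at], but the drift is
     required along every history. *)
  by rewrite leqNgt ltn_neqAle eq_sym j_neq j_ge /=; lra.
have rhoE : rho = ~~ d by case: (rho) (d) rho_d => [] [].
have rhoF := negbTE rho_d.
case: stop own => _; last first.
  (* Waiting raises the mean of [24 ^ j] by [23 / 24], hence the potential by less than the allowed
     [1 / 8]. *)
  by rewrite !big_cons big_nil /lyapunov /= rhoF (exprS _ j) -/y -/A /rate; lra.
case: ifP => [/andP[j_gt0 /eqP odd_j]|_]; last first.
  by rewrite big_seq1 /lyapunov /= rhoF expr0 -/y -/A; nra.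
rewrite !big_cons big_nil /lyapunov /= rhoF rhoE negbK eqxx expr0 -/y -/A -/z.
(* What remains is [72 * A <= 72 * A ^ 2 * z + y / 8]. The risk term suffices when [y <= A], the
   time term when [y >= 576 * A]; the level between, where this fails, has the wrong parity for the
   opponent. *)
have [j_lt|j_ge] := leqP j m.
  have yA : y <= A by rewrite /y /A ler_eXn2l // ltr1n.
  by nra.
have j_gt : (m.+2 <= j)%N.
  rewrite ltn_neqAle j_ge andbT; apply/eqP => jE.
  by move: rho_d; rewrite -odd_j -jE odd_k eqxx.
have yA : 576%:R * A <= y.
  by rewrite (_ : _ * A = 24%:R ^+ m.+2) ?ler_eXn2l ?ltr1n // !exprS -/A; ring.
by nra.
Qed.

Lemma guarantee sigma tau d m : odd m.+1 = d -> stops_at sigma tau d m.+1 ->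
  path_total (fun k' : state game => (k'.1 == d)%:R) sigma tau (24 ^ (2 * m.+1)) [::]
    (true, Some None) <= 4%:R^-1 * (24 ^ (2 * m.+1))%:R.
Proof.
move=> odd_k stops.
have nE : (24 ^ (2 * m.+1))%:R = 576%:R * (24%:R ^+ m) ^+ 2 :> R.
  by rewrite natrX mulnC exprM (exprS _ m); ring.
have A1 := pow24_ge1 m.
have := @lyapunov_bound sigma tau d start (lyapunov d m) 8%:R^-1 (24 ^ (2 * m.+1))
  (lyapunov_ge0 d m) _ _ _ _ [::] (leqnn _).
rewrite /expected_loss big_seq1 mul1r => bound.
apply: le_trans (bound _ _ _) _ => {bound}.
- by lra.
- by rewrite /lyapunov /= eqxx nE.
- move=> h a a_pos; set x := position_after start h => x_alive; apply: lyapunov_drift => // x_d.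
  have : stop_at d m.+1 h (active x.1 a) != 0.
    rewrite x_d.
    move: a_pos; rewrite mulf_eq0 negb_or -stops => /andP[].
    by case: (d).
  by rewrite diracE pnatr_eq0 eqb0 negbK -/x x_d => /eqP.
(* The initial potential, at most [72 * A ^ 2], and the accumulated drift each cost at most an
   eighth of the horizon. *)
- rewrite nE /lyapunov /= expr0; case: ifP => _; nra.
Qed.

End Game.

(** * Beliefs as normalized linear filters *)

Section Filter.
Context (R : realType) (G : hidden_game R).
Implicit Types (u : state G -> R) (o : observation G).

(** One step of the unnormalized filter. The choice probabilities are left out: being common to all
    states, they cancel in the belief. *)
Definition push u o (k' : state G) : R :=
  \sum_k u k * transition k o.1.1 o.1.2 (k', o.2).

Lemma push_ge0 u o : (forall k, 0 <= u k) -> forall k, 0 <= push u o k.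
Proof. by move=> u_ge0 k; apply: sumr_ge0 => l _; rewrite mulr_ge0 ?dist_ge0. Qed.

Lemma pushes_ge0 u (h : seq (observation G)) :
  (forall k, 0 <= u k) -> forall k, 0 <= foldl push u h k.
Proof. by elim: h u => //= o h IHh u u_ge0; apply/IHh/push_ge0. Qed.

Lemma observe_sum o (F : step G -> R) :
  \sum_x (observe x == o)%:R * F x = \sum_k F (o.1, (k, o.2)).
Proof.
case: o => oa os; rewrite step_sum (bigD1 oa) //= [X in _ + X]big1 ?addr0; last first.
  by move=> a /negbTE a_neq; apply: big1 => y _; rewrite xpair_eqE a_neq mul0r.
transitivity (\sum_k \sum_s (s == os)%:R * F (oa, (k, s))).
  by rewrite pair_big; apply: eq_bigr => -[k s] _; rewrite xpair_eqE eqxx.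
apply: eq_bigr => k _; rewrite (bigD1 os) //= eqxx mul1r big1 ?addr0 //.
by move=> s /negbTE ->; rewrite mul0r.
Qed.

Definition traced_mass u (h : seq (observation G)) (k k1 : state G)
    (w : seq (step G)) : R :=
  ((last k1 [seq x.2.1 | x <- w] == k) && (map (@observe R G) w == h))%:R *
  (u k1 * nature_prob k1 w).

Lemma traced_mass_cons u o h k k1 x w : traced_mass u (o :: h) k k1 (x :: w) =
  (observe x == o)%:R *
    traced_mass (fun=> u k1 * transition k1 x.1.1 x.1.2 x.2) h k x.2.1 w.
Proof.
case: x => -[i j] [k' s]; rewrite /traced_mass /= eqseq_cons.
by rewrite [RHS]mulrA -natrM mulnb andbCA !mulrA.
Qed.

(** Once the first observation is fixed, only the next hidden state is left to sum over, which
    amounts to one [push]. *)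
Lemma traced_mass_sum u n (h : seq (observation G)) k : size h = n ->
  \sum_k1 \sum_(w : n.-tuple (step G)) traced_mass u h k k1 w = foldl push u h k.
Proof.
elim: h n u => [|o h IHh] [|n] u //=.
  move=> _; rewrite (bigD1 k) //= [X in _ + X]big1 ?addr0.
    by rewrite (big_tuple0 (traced_mass _ _ _ _)) /traced_mass /= eqxx mul1r mulr1.
  move=> k1 /negbTE k1_neq.
  by rewrite (big_tuple0 (traced_mass _ _ _ _)) /traced_mass /= k1_neq mul0r.
case=> sz; rewrite -(IHh n (push u o) sz).
under eq_bigr => k1 _.
  rewrite (big_tuple_cons _ (traced_mass _ _ _ _)).
  under eq_bigr => x _.
    under eq_bigr => w _ do rewrite traced_mass_cons.
    rewrite -mulr_sumr; over.
  rewrite observe_sum; over.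
rewrite exchange_big; apply: eq_bigr => k' _ /=.
rewrite exchange_big; apply: eq_bigr => w _ /=.
by rewrite /traced_mass /push mulr_suml mulr_sumr.
Qed.

Lemma admissible_belief (b : dist R (state G)) m (h : history G m) :
  admissible b h ->
  0 < \sum_k foldl push b h k /\
  forall k, belief b h k = foldl push b h k / \sum_l foldl push b h l.
Proof.
case=> sigma [tau h_pos].
have stateE k : \sum_(w : play G m | (play_state w == k) && (play_history w == h))
    b w.1 * nature_prob w.1 w.2 = foldl push b h k.
  rewrite -(@traced_mass_sum b m.-1) ?size_tuple // pair_big /= big_mkcond /=.
  apply: eq_bigr => -[k1 w] _ /=; rewrite /play_state /play_history -val_eqE /traced_mass /=.
  by case: ifP => _; rewrite ?mul1r ?mul0r.
have histE : history_prob b sigma tau h =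
    choice_prob sigma tau [::] h * \sum_k foldl push b h k.
  apply: etrans (Pr_history b sigma tau h predT) _; congr (_ * _).
  rewrite (partition_big (@play_state R G m) predT) //=; apply: eq_bigr => k _.
  by rewrite -stateE; apply: eq_bigl => w; rewrite andbC.
have S_ge0 : 0 <= \sum_k foldl push b h k.
  by apply: sumr_ge0 => k _; apply: pushes_ge0 => l; exact: dist_ge0.
have := lt0r_neq0 h_pos; rewrite histE mulf_eq0 negb_or => /andP[c_neq0 S_neq0].
split; first by rewrite lt_def S_neq0.
move=> k; rewrite (belief_posterior h_pos) ffunE Pr_history stateE histE.
by rewrite -mulf_div divff // mul1r.
Qed.

End Filter.

(** * Forgetting the initial belief *)

Section Ergodicity.
Context (R : realType).
Implicit Types (u : hidden_state -> R) (o : observation (game R)).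
Local Notation rate := (rate R).
Local Notation push := (@push R (game R)).

Lemma lawE (k : hidden_state) stop k' s : law R k stop (k', s) =
  (s == publicize k')%:R * \sum_(x <- outcomes R k stop) x.1 * (x.2 == k')%:R.
Proof.
rewrite /law /= ffunE big_map mulr_sumr; apply: eq_bigr => x _ /=.
rewrite xpair_eqE mulrCA -natrM mulnb andbC eq_sym; congr (_ * _%:R).
by case: (x.2 =P k') => [->|]; rewrite ?andbF // !andbT eq_sym.
Qed.

Lemma push_unannounced u o k : publicize k != o.2 -> push u o k = 0.
Proof.
move=> /negbTE k_neq; apply: big1 => l _.
by rewrite [transition _ _ _ _]lawE eq_sym k_neq mul0r mulr0.
Qed.

Definition clock (rho odd bad : bool) : hidden_state := (rho, Some (Some (odd, bad))).

Lemma clock_sum rho odd (F : hidden_state -> R) :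
  (forall k, publicize k != (rho, Some (Some odd)) -> F k = 0) ->
  \sum_k F k = F (clock rho odd true) + F (clock rho odd false).
Proof.
move=> F0; rewrite (bigD1 (clock rho odd true)) //=; congr (_ + _).
rewrite (bigD1 (clock rho odd false)) /=; last by apply/eqP; case.
rewrite big1 ?addr0 // => k /andP[k1 k2].
apply: F0; apply: contra k1 => k_pub; move: k_pub k2.
by case: k => r [[[e []]|]|] //= /eqP[-> ->]; rewrite eqxx.
Qed.

(* Two unnormalized filters along one history: either they have the same
   direction, or both know the clock up to a small mass on the flawed state. *)
Definition merged (t : R) u u' : Prop :=
  (forall k l, u k * u' l = u l * u' k) \/
  exists rho odd,
    [/\ forall k, publicize k != (rho, Some (Some odd)) -> u k = 0 /\ u' k = 0,
        u (clock rho odd true) <= t * \sum_k u k &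
        u' (clock rho odd true) <= t * \sum_k u' k].

(** [publicize] hides only the flaw of an advanced clock. Any other signal determines the state, so
    both filters sit on one point. *)
Lemma push_revealed u u' o : (if o.2.2 is Some (Some _) then false else true) ->
  forall k l, push u o k * push u' o l = push u o l * push u' o k.
Proof.
move=> revealed k l.
have [k_o|k_o] := eqVneq (publicize k) o.2; last first.
  by rewrite !(push_unannounced _ k_o) mul0r mulr0.
have [l_o|l_o] := eqVneq (publicize l) o.2; last first.
  by rewrite !(push_unannounced _ l_o) mul0r mulr0.
suff -> : k = l by [].
move: k_o revealed; rewrite -l_o.
by case: k l {l_o} => r [[[e b]|]|] [r' [[[e' b']|]|]] //= [->].
Qed.

Lemma merged1 u u' o : (forall k, 0 <= u k) -> (forall k, 0 <= u' k) ->
  merged 1 (push u o) (push u' o).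
Proof.
move=> u_ge0 u'_ge0.
have bad_le v rho odd : (forall k, 0 <= v k) ->
    push v o (clock rho odd true) <= 1 * \sum_k push v o k.
  move=> v_ge0; rewrite mul1r (bigD1 (clock rho odd true)) //= lerDl.
  by apply: sumr_ge0 => k _; exact: push_ge0.
have := @push_revealed u u' o.
case oE : o => [a [rho [[odd|]|]]] /=; rewrite -oE => revealed.
- right; exists rho, odd; split; try exact: bad_le.
  by move=> k; rewrite [(rho, _)](_ : _ = o.2) ?oE // -oE => k_o; rewrite !push_unannounced.
- by left; apply: revealed.
- by left; apply: revealed.
Qed.

(** [c] tests whether the observation is an advance of this clock. If so, both masses carry the
    factor [rate], and the flawed one carries it twice. *)
Lemma push_clock u o rho odd rho' odd' :
  (forall k, publicize k != (rho, Some (Some odd)) -> u k = 0) ->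
  o.2 = (rho', Some (Some odd')) ->
  let c := [&& ~~ active rho o.1, rho' == rho & odd' == ~~ odd]%:R in
  push u o (clock rho' odd' true) = c * (rate * rate * u (clock rho odd true)) /\
  push u o (clock rho' odd' false) = c * (rate * (1 - rate) * u (clock rho odd true) +
    rate * u (clock rho odd false)).
Proof.
move=> u0 oE c.
have sum_pos k' : push u o k' = u (clock rho odd true) *
      law R (clock rho odd true) (active rho o.1) (k', o.2) +
    u (clock rho odd false) * law R (clock rho odd false) (active rho o.1) (k', o.2).
  rewrite /push (@clock_sum rho odd); last by move=> k /u0 ->; rewrite mul0r.
  by rewrite /= -surjective_pairing.
rewrite !sum_pos !lawE oE /c.
move: (u (clock rho odd true)) (u (clock rho odd false)) (active rho o.1).
move=> bad good stop {u0 oE c sum_pos}.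
by case: stop; case: rho; case: odd; case: rho'; case: odd';
   rewrite /= ?big_cons ?big_nil /=; split; ring.
Qed.

(** At an advance the total mass is multiplied by [rate] and the flawed mass by its square, so the
    flawed share shrinks by [rate]. Proportional filters stay so by linearity. *)
Lemma merged_push t u u' o : 0 <= t -> (forall k, 0 <= u k) -> (forall k, 0 <= u' k) ->
  merged t u u' -> merged (rate * t) (push u o) (push u' o).
Proof.
move=> t_ge0 u_ge0 u'_ge0 [same|[rho [odd [supp bad bad']]]].
  left=> k l; rewrite /push !big_distrlr /= [RHS]exchange_big /=.
  apply: eq_bigr => x _; apply: eq_bigr => y _.
  by rewrite [LHS]mulrACA (same x y) [RHS]mulrACA [X in _ = _ * X]mulrC.
have := @push_revealed u u' o.
case oE : o.2 => [rho' [[odd'|]|]] revealed; [right | by left; apply: revealed..].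
exists rho', odd'.
have half v : (forall k, publicize k != (rho, Some (Some odd)) -> v k = 0) ->
    v (clock rho odd true) <= t * \sum_k v k ->
    push v o (clock rho' odd' true) <= rate * t * \sum_k push v o k.
  move=> v0; rewrite (clock_sum v0) => v_bad.
  rewrite (@clock_sum rho' odd'); last by move=> k; rewrite -oE; exact: push_unannounced.
  have [-> ->] := push_clock v0 oE.
  case: [&& _, _ & _]; rewrite ?mul1r ?mul0r ?addr0 ?mulr0 //.
  move: (v (clock rho odd true)) (v (clock rho odd false)) v_bad => x y x_le.
  rewrite (_ : rate * t * _ = rate * rate * (t * (x + y))); last by ring.
  by rewrite ler_wpM2l // mulr_ge0 // rate_ge0.
split.
- by move=> k; rewrite -oE => k_o; rewrite !push_unannounced.
- by apply: half => // k /supp[].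
- by apply: half => // k /supp[].
Qed.

Lemma merged_pushes t u u' (h : seq (observation (game R))) : 0 <= t ->
  (forall k, 0 <= u k) -> (forall k, 0 <= u' k) -> merged t u u' ->
  merged (rate ^+ size h * t) (foldl push u h) (foldl push u' h).
Proof.
elim: h t u u' => [|o h IHh] t u u' t_ge0 u_ge0 u'_ge0 m_uu' /=.
  by rewrite expr0 mul1r.
rewrite exprSr -mulrA; apply: IHh.
- by rewrite mulr_ge0 // rate_ge0.
- exact: (@push_ge0 R (game R)).
- exact: (@push_ge0 R (game R)).
- exact: merged_push.
Qed.

(** On two points the distance is twice the gap between the flawed shares, which both lie between 0
    and [t]. *)
Lemma merged_dist t u u' : 0 <= t -> (forall k, 0 <= u k) -> (forall k, 0 <= u' k) ->
  0 < \sum_k u k -> 0 < \sum_k u' k -> merged t u u' ->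
  \sum_k `|u k / (\sum_l u l) - u' k / (\sum_l u' l)| <= 2%:R * t.
Proof.
move=> t_ge0 u_ge0 u'_ge0 U_gt0 U'_gt0 [same|[rho [odd [supp]]]].
  rewrite big1 ?mulr_ge0 // => k _; apply/eqP; rewrite normr_eq0 subr_eq0.
  rewrite eqr_div ?lt0r_neq0 // !mulr_sumr; apply/eqP/eq_bigr => l _.
  by rewrite same mulrC.
set U := \sum_k u k in U_gt0 *; set U' := \sum_k u' k in U'_gt0 * => bad bad'.
have UE : U = u (clock rho odd true) + u (clock rho odd false).
  by apply: clock_sum => k /supp[].
have U'E : U' = u' (clock rho odd true) + u' (clock rho odd false).
  by apply: clock_sum => k /supp[].
rewrite (@clock_sum rho odd); last first.
  by move=> k /supp[-> ->]; rewrite !mul0r subrr normr0.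
have goodE : u (clock rho odd false) / U = 1 - u (clock rho odd true) / U.
  by rewrite -[1](divff (lt0r_neq0 U_gt0)) -mulrBl {2}UE addrC addKr.
have good'E : u' (clock rho odd false) / U' = 1 - u' (clock rho odd true) / U'.
  by rewrite -[1](divff (lt0r_neq0 U'_gt0)) -mulrBl {2}U'E addrC addKr.
have x_ge0 : 0 <= u (clock rho odd true) / U by rewrite divr_ge0 // ltW.
have x'_ge0 : 0 <= u' (clock rho odd true) / U' by rewrite divr_ge0 // ltW.
have x_le : u (clock rho odd true) / U <= t by rewrite ler_pdivrMr.
have x'_le : u' (clock rho odd true) / U' <= t by rewrite ler_pdivrMr.
rewrite goodE good'E.
set x := _ / U in x_ge0 x_le *; set x' := _ / U' in x'_ge0 x'_le *.
have d_le : `|x - x'| <= t by rewrite ler_norml; lra.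
rewrite (_ : 1 - x - (1 - x') = - (x - x')) ?normrN; [lra | ring].
Qed.

Lemma game_weakly_ergodic : weakly_ergodic (game R).
Proof.
(* Histories at stage [n.+2] have [n.+1] entries: the first yields [merged 1], and each of the other
   [n] contributes a factor [rate]. *)
move=> eps eps_gt0; pose n := Num.bound (2%:R / eps); exists n.+2; split=> // b b' h.
move=> /admissible_belief[U_gt0 bE] /admissible_belief[U'_gt0 b'E].
under eq_bigr => k _ do rewrite bE b'E.
have q0 := rate_ge0 R.
have b_ge0 := dist_ge0 b; have b'_ge0 := dist_ge0 b'.
apply: le_trans (_ : 2%:R * rate ^+ n <= _).
  apply: merged_dist => //; try exact: (@pushes_ge0 R (game R)); first by rewrite exprn_ge0.
  case: h {U_gt0 bE U'_gt0 b'E} => -[|o h] //= /eqP[<-]; rewrite -[rate ^+ _]mulr1.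
  by apply: merged_pushes; [exact: ler01 | exact: (@push_ge0 R (game R)) |
    exact: (@push_ge0 R (game R)) | exact: merged1].
have pow_gt0 : 0 < 24%:R ^+ n :> R by rewrite exprn_gt0.
rewrite /rate exprVn ler_pdivrMr // mulrC -ler_pdivrMr //.
have n_gt : 2%:R / eps < n%:R by apply: archi_boundP; rewrite divr_ge0 // ltW.
by apply: ltW (lt_trans n_gt _); rewrite -natrX ltr_nat ltn_expl.
Qed.

End Ergodicity.

(** * Oscillation of the guarantees with the horizon *)

Lemma game_no_uniform_value (R : realType) : ~ has_uniform_value (game R).
Proof.
case=> v [_ v_uniform].
pose k1 : hidden_state := (true, Some None).
pose b : dist R (state (game R)) := dirac R k1.
have [|sigma' [tau' [nbar [_ value]]]] := v_uniform b 8%:R^-1; first by lra.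
pose phi d (k : state (game R)) : R := (k.1 == d)%:R.
have gamma_b n sigma tau :
    gamma n b sigma tau = n%:R^-1 * path_total (phi false) sigma tau n [::] k1.
  rewrite (@gammaE _ _ (phi false)) ?dirac_sum // => -[[] c] i j //=.
have n_ge m : (nbar <= m)%N -> (nbar <= 24 ^ (2 * m.+1))%N.
  by move=> m_ge; apply: leq_trans (ltnW (ltn_expl _ _)); lia.
have n_gt0 m : 0 < (24 ^ (2 * m.+1))%:R :> R by rewrite ltr0n expn_gt0.
have high : 4%:R^-1 * 3%:R <= v b + 8%:R^-1.
  pose m := (2 * nbar)%N; pose sigma := stop_at true m.+1 : strategy1 (game R).
  have odd_m : odd m.+1 = true by rewrite /m mul2n /= odd_double.
  have m_ge : (nbar <= m)%N by rewrite leq_pmull.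
  have [_ /(_ sigma)] := value _ (n_ge m m_ge).
  apply: le_trans; rewrite gamma_b.
  have := @guarantee R sigma tau' true m odd_m (fun=> erefl).
  (* Each stage costs one unit to exactly one player, so a loss of at most a quarter for Player 1
     means a payoff of at least [3 / 4]. *)
  have := path_totalD (phi true) (phi false) sigma tau' (24 ^ (2 * m.+1)) [::] k1.
  rewrite (_ : (fun k => phi true k + phi false k) = (fun=> 1)); last first.
    by apply/funext => -[[] c]; rewrite /phi /= ?addr0 ?add0r.
  rewrite path_total1 -/(phi true) => splitE lost_le.
  by rewrite [leRHS]mulrC ler_pdivlMr //; lra.
have low : v b - 8%:R^-1 <= 4%:R^-1.
  pose m := (2 * nbar).+1; pose tau := stop_at false m.+1 : strategy2 (game R).
  have odd_m : odd m.+1 = false by rewrite /m mul2n /= odd_double.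
  have m_ge : (nbar <= m)%N by apply: leqW; rewrite leq_pmull.
  have [/(_ tau) v_le _] := value _ (n_ge m m_ge).
  apply: le_trans v_le _; rewrite gamma_b mulrC ler_pdivrMr //.
  exact: (@guarantee R sigma' tau false m odd_m (fun=> erefl)).
(* [high] and [low] would give [5 / 8 <= v b <= 3 / 8]. *)
lra.
Qed.

Theorem theorem6p4 (R : realType) :
  exists G : hidden_game R, weakly_ergodic G /\ ~ has_uniform_value G.
Proof.
exists (game R); split; [exact: game_weakly_ergodic | exact: game_no_uniform_value].
Qed.
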